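(* The communication complexity of constructing a $+2$-spanner of an unweighted undirected distributed graph on $n$ vertices with edges observed at $s$ sites in the blackboard model with duplication is $\Omega(s+n^{3/2}\log s)$, and the same lower bound $\Omega(s+n^{3/2}\log s)$ holds for the communication complexity of constructing a $3$-spanner.
   Context: Distributed graph: there are $s$ sites $S_1,\dots,S_s$; all know the common vertex set $V$, $|V|=n$, and site $S_i$ holds a subset $E_i\subseteq E$ of the edges of an undirected graph $G=(V,E)$, where $E=\bigcup_{i=1}^s E_i$. In the duplication setting the sets $E_i$ may intersect. Blackboard model: sites communicate by writing messages on a shared blackboard (a broadcast channel) visible to all sites and to a coordinator, who must output the result. The communication cost of a protocol is the total number of bits communicated (in the worst case); the communication complexity of a problem is the least communication cost of a (randomized, bounded constant error) protocol solving it. Spanners: a subgraph $H=(V,E')$, $E'\subseteq E$, is a $+2$-spanner of $G$ if $d_H(u,v)\le d_G(u,v)+2$ for all $u,v\in V$, and a $3$-spanner of $G$ if $d_H(u,v)\le 3\,d_G(u,v)$ for all $u,v\in V$, where $d$ denotes shortest-path distance. *)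

(* Defs.v *)
From HB Require Import structures.
From mathcomp Require Import all_boot all_order all_algebra.
From mathcomp Require Import all_classical all_reals all_analysis.

Set Implicit Arguments.
Unset Strict Implicit.
Unset Printing Implicit Defensive.

Import Order.TTheory GRing.Theory Num.Theory.

Local Open Scope classical_set_scope.
Local Open Scope ring_scope.

(** Graphs on the vertex set 'I_n and spanners *)

(* Potential edges of a simple undirected graph: 2-element vertex sets, so that
   every term of type {set edge n} is the edge set of such a graph. *)
Definition edge (n : nat) : finType := {e : {set 'I_n} | #|e| == 2%N}.

Definition adj (n : nat) (E : {set edge n}) : rel 'I_n :=
  fun u v => [exists e : edge n, (e \in E) && (val e == [set u; v]%SET)].

(* Shortest-path distance; it is +oo when v is not reachable from u. *)
Definition dist (R : realType) (n : nat) (E : {set edge n}) (u v : 'I_n)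
    : \bar R :=
  ereal_inf [set (size p)%:R%:E |
    p in [set p : seq 'I_n | path (adj E) u p /\ last u p = v]].

Definition plus2_spanner (R : realType) (n : nat) (G H : {set edge n}) : Prop :=
  H \subset G /\
  forall u v : 'I_n, (dist R H u v <= dist R G u v + 2%:E)%E.

Definition three_spanner (R : realType) (n : nat) (G H : {set edge n}) : Prop :=
  H \subset G /\
  forall u v : 'I_n, (dist R H u v <= 3%:E * dist R G u v)%E.

(** The blackboard model *)

(* A deterministic protocol for s sites with inputs in X and a result in Y.
   A position in the tree is the current content of the blackboard.  At
   [Write i f k], site i writes the bit [f x_i], computed from its own input and
   the board, and the protocol goes on as [k (f x_i)]; longer messages are
   sequences of such bits.  At [Output y] the coordinator, who has no input and
   only reads the board, returns y. *)
Inductive det_protocol (s : nat) (X Y : Type) : Type :=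
| Output of Y
| Write (i : 'I_s) (f : X -> bool) (k : bool -> det_protocol s X Y).

Fixpoint run (s : nat) (X Y : Type) (p : det_protocol s X Y) (x : 'I_s -> X)
    : Y :=
  match p with
  | Output y => y
  | Write i f k => run (k (f (x i))) x
  end.

Fixpoint bits (s : nat) (X Y : Type) (p : det_protocol s X Y) (x : 'I_s -> X)
    : nat :=
  match p with
  | Output _ => 0%N
  | Write i f k => (bits (k (f (x i))) x).+1
  end.

(* Coins are public, which subsumes private coins of the sites and of the
   coordinator.  A finite sample space is no restriction: only finitely many
   deterministic protocols have worst-case cost below a bound, up to subtrees that no
   input reaches. *)
Record protocol (R : realType) (s : nat) (X Y : Type) : Type := Protocol {
  coins : finType;
  coin_prob : coins -> R;
  coin_prob_ge0 : forall r, 0 <= coin_prob r;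
  coin_prob_sum1 : \sum_r coin_prob r = 1;
  strategy : coins -> det_protocol s X Y }.

(* Worst case over the inputs and the coins. *)
Definition cost (R : realType) (s : nat) (X : finType) (Y : Type)
    (P : protocol R s X Y) : nat :=
  \max_(r : coins P) \max_(x : {ffun 'I_s -> X}) bits (strategy r) x.

Definition success_prob (R : realType) (s : nat) (X : finType) (Y : Type)
    (task : {ffun 'I_s -> X} -> Y -> Prop) (P : protocol R s X Y)
    (x : {ffun 'I_s -> X}) : R :=
  \sum_(r : coins P | `[< task x (run (strategy r) x) >]) coin_prob r.

Definition solves (R : realType) (s : nat) (X : finType) (Y : Type)
    (delta : R) (task : {ffun 'I_s -> X} -> Y -> Prop) (P : protocol R s X Y)
    : Prop :=
  forall x : {ffun 'I_s -> X}, 1 - delta <= success_prob task P x.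

(* The least cost of a protocol with error at most delta on every input. *)
Definition comm_complexity (R : realType) (s : nat) (X : finType) (Y : Type)
    (delta : R) (task : {ffun 'I_s -> X} -> Y -> Prop) : \bar R :=
  ereal_inf [set c : \bar R | exists P : protocol R s X Y,
    solves delta task P /\ c = (cost P)%:R%:E].

(** Distributed spanner construction *)

(* The edge sets E i are arbitrary: they may intersect (duplication). *)
Definition union_graph (n s : nat) (E : {ffun 'I_s -> {set edge n}})
    : {set edge n} :=
  (\bigcup_(i < s) E i)%SET.

Definition plus2_spanner_task (R : realType) (n s : nat)
    (E : {ffun 'I_s -> {set edge n}}) (H : {set edge n}) : Prop :=
  plus2_spanner R (union_graph E) H.

Definition three_spanner_task (R : realType) (n s : nat)
    (E : {ffun 'I_s -> {set edge n}}) (H : {set edge n}) : Prop :=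
  three_spanner R (union_graph E) H.

(* Main.v *)
(**
  Let F be the incidence graph of the points and non-vertical lines of the
  affine plane over a field with q = 2^k elements, 2 q^2 <= n < 8 q^2: it has
  q^3 edges and no 4-cycle, hence girth at least 6.  An edge of a subgraph G of
  F cannot be replaced by a path of length at most 3, so the only +2-spanner
  or 3-spanner of G is G itself, and the sites have to compute the union of
  arbitrary subsets of F.

  Term s: a site which is silent on the empty input cannot signal a single
  edge, so for each site the probability that it speaks is at least
  1 - 2 delta.

  Term |F| log s, for large s: amplify the success probability by a majority
  vote, and let each site hold each edge independently with probability 1/s.
  Given a transcript l the sites stay independent; let p(l, i, j) be the
  conditional probability that site i holds edge j.  On average
  sum_i p(l, i, j) = 1.  If most of this mass came from values below
  1/sqrt s, then an edge reported as present would be absent with probability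
  prod_i (1 - p(l, i, j)), which is bounded below, contradicting correctness.
  So a constant mass per edge comes from p(l, i, j) >= 1/sqrt s, where the
  transcript has increased the probability by the factor sqrt s.  An
  exponential moment over the input then shows that the logarithm of the
  number of transcripts is at least of order |F| log s.  For bounded s it
  suffices that a single site has to transmit an arbitrary subset of F.
*)

Require Import Defs.
From mathcomp Require Import all_boot all_order all_algebra.
From mathcomp Require Import all_classical all_reals all_analysis.
From mathcomp Require Import finfield lra ring zify.

Set Implicit Arguments.
Unset Strict Implicit.
Unset Printing Implicit Defensive.

Import Order.TTheory GRing.Theory Num.Theory.

Local Open Scope ring_scope.

(** * Transcripts and amplification *)

Section Transcripts.
Variables (s : nat) (X Y : Type).
Implicit Types (p : det_protocol s X Y) (x : 'I_s -> X) (l : seq bool).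

(* Padded with [false] up to length C, so that all transcripts live in the
   finite type [C.-tuple bool]. *)
Fixpoint transcript (C : nat) p x : seq bool :=
  if C is C'.+1 then
    match p with
    | Output _ => false :: transcript C' p x
    | Write i f k => f (x i) :: transcript C' (k (f (x i))) x
    end
  else [::].

(** The condition that [l] puts on site i alone; bits of other sites only steer the descent. A
    padding bit must be [false] for every site. *)
Fixpoint compatible p l (i : 'I_s) (a : X) : bool :=
  if l is b :: l' then
    match p with
    | Output _ => ~~ b && compatible p l' i a
    | Write j f k => ((j == i) ==> (f a == b)) && compatible (k b) l' i a
    end
  else true.

Fixpoint transcript_output (y0 : Y) p l : Y :=
  match p with
  | Output y => y
  | Write _ _ k => if l is b :: l' then transcript_output y0 (k b) l' else y0
  end.

Fixpoint speaks p x (i : 'I_s) : bool :=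
  match p with
  | Output _ => false
  | Write j f k => (j == i) || speaks (k (f (x j))) x i
  end.

Lemma size_transcript C p x : size (transcript C p x) == C.
Proof. by elim: C p => [|C IH] [y|i f k] //=; rewrite eqSS. Qed.

(** Each bit depends on the input of one site, so reaching [l] splits into one condition per site.
    The site [i0] is there to reject a [true] padding bit, which an empty conjunction would
    accept. *)
Lemma transcript_rectangle (i0 : 'I_s) C p x l : size l = C ->
  (transcript C p x == l) = [forall i, compatible p l i (x i)].
Proof.
move=> <-; elim: l p => [|b l IH] [y|j f k] /=; try by apply/esym/forallP.
  rewrite eqseq_cons IH; case: b => /=.
    by apply/esym/negP => /forallP /(_ i0).
  by apply: eq_forallb.
rewrite eqseq_cons; have [E|nE] /= := eqVneq (f (x j)) b.
  rewrite E IH; apply: eq_forallb => i.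
  by case: (eqVneq j i) => [<-|]; rewrite ?E ?eqxx.
by apply/esym/negP => /forallP /(_ j); rewrite eqxx (negbTE nE).
Qed.

Lemma transcript_outputE y0 C p x : (bits p x <= C)%N ->
  transcript_output y0 p (transcript C p x) = run p x.
Proof. by elim: p C => [y|i f k IH] [|C] //= h; rewrite IH. Qed.

Lemma card_speakers p x : (#|[pred i | speaks p x i]| <= bits p x)%N.
Proof.
elim: p => [y|j f k IH] /=; first by rewrite eq_card0.
rewrite (@eq_card _ _ [predU1 j & [pred i | speaks (k (f (x j))) x i]]).
  by rewrite cardU1 -add1n leq_add ?leq_b1 ?IH.
by move=> i; rewrite !inE eq_sym.
Qed.

(** The path through the tree depends only on the inputs of the sites that speak along it. *)
Lemma run_silent p x x' i : ~~ speaks p x i ->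
  (forall j, j != i -> x' j = x j) -> run p x' = run p x.
Proof.
move=> + eqx; elim: p => [y|j f k IH] //=; rewrite negb_or => /andP[ji /IH <-].
by rewrite eqx.
Qed.

End Transcripts.

(** * Majority votes with fixed coins *)

Section Amplification.
Variables (R : realType) (coinT : finType) (pr : coinT -> R).
Hypothesis pr_ge0 : forall r, 0 <= pr r.
Hypothesis pr_sum1 : \sum_r pr r = 1.
Variables (X : finType) (mu : X -> R).
Hypothesis mu_ge0 : forall x, 0 <= mu x.
Hypothesis mu_sum1 : \sum_x mu x = 1.
Variables (err : coinT -> X -> bool) (delta : R).
Hypotheses (delta_gt0 : 0 < delta) (delta_lt_half : delta < 2^-1).
Hypothesis err_prob : forall x, \sum_(r | err r x) pr r <= delta.

(** A tie counts as an error, so no error means a strict majority of correct runs. *)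
Definition majority_err (t : nat) (rv : 'I_t -> coinT) (x : X) : bool :=
  (t <= 2 * #|[pred k | err (rv k) x]|)%N.

(* Chernoff's bound, with the exponential base [1 / (2 delta)]. *)
Lemma majority_err_prob t x :
  \sum_(rv : {ffun 'I_t -> coinT} | majority_err rv x) \prod_k pr (rv k)
    <= (2^-1 + 2 * delta * (1 - delta)) ^+ t.
Proof.
pose a := 2 * delta.
have [dt0 dth] := (delta_gt0, delta_lt_half).
have a0 : 0 < a by rewrite /a; lra.
have a1 : a <= 1 by rewrite /a; lra.
pose z r := if err r x then a^-1 else a.
have z0 r : 0 <= z r by rewrite /z; case: ifP; rewrite ?invr_ge0 ltW.
(* As [a <= a^-1], the mean of [z] grows with the error probability, and error [delta] gives the
   bound. *)
have Ez : \sum_r pr r * z r <= 2^-1 + 2 * delta * (1 - delta).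
  rewrite (bigID (err^~ x)) /=.
  under eq_bigr => r h do rewrite /z h.
  under [X in _ + X]eq_bigr => r h do rewrite /z (negbTE h).
  rewrite -!mulr_suml.
  have := err_prob x; have := pr_sum1; rewrite (bigID (err^~ x)) /=.
  set d := \sum_(r | err r x) _; set d' := \sum_(r | ~~ _) _ => dd dle.
  have -> : d' = 1 - d by lra.
  have aa : 1 <= a^-1 by rewrite invf_ge1.
  have -> : 2^-1 + 2 * delta * (1 - delta) = delta * a^-1 + (1 - delta) * a.
    by rewrite /a; field; rewrite gt_eqF.
  rewrite -subr_ge0 (_ : _ - _ = (delta - d) * (a^-1 - a)); last by ring.
  by rewrite mulr_ge0 //; lra.
have Ez0 : 0 <= \sum_r pr r * z r by apply: sumr_ge0 => r _; rewrite mulr_ge0.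
apply: le_trans (_ : (\sum_r pr r * z r) ^+ t <= _); last first.
  by rewrite lerXn2r // nnegrE // (le_trans Ez0).
rewrite -[X in _ ^+ X](card_ord t) -prodr_const bigA_distr_bigA /=.
rewrite [leRHS](bigID (fun rv : {ffun _ -> _} => majority_err rv x)) /=.
apply: ler_wpDr.
  by apply: sumr_ge0 => rv _; apply: prodr_ge0 => k _; rewrite mulr_ge0.
(* In a majority error at least as many factors equal [a^-1] as [a], so the product of the [z] is at
   least 1. *)
apply: ler_sum => rv maj; rewrite big_split /= ler_peMr //.
  exact: prodr_ge0.
rewrite (bigID (fun k => err (rv k) x)) /=.
under eq_bigr => k h do rewrite /z h.
under [X in _ * X]eq_bigr => k h do rewrite /z (negbTE h).
rewrite !prodr_const.
have := cardC [pred k | err (rv k) x]; rewrite card_ord.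
rewrite (_ : #|[predC _]| = #|(fun k => ~~ err (rv k) x)|) //.
move: maj; rewrite /majority_err -/(#|_|).
set u := #|_|; set v := #|_| => h1 h2.
have vu : (v <= u)%N by lia.
rewrite -(subnK vu) exprD -mulrA exprVn -exprMn mulVf ?gt_eqF // expr1n mulr1.
by rewrite invf_ge1 ?exprn_gt0 // exprn_ile1 // ltW.
Qed.

(** The bound holds for each input, hence for the mean under [mu]; some choice of coins does no
    worse than the average over coins. *)
Lemma derandomized_majority t : exists rv : 'I_t -> coinT,
  \sum_(x | majority_err rv x) mu x <= (2^-1 + 2 * delta * (1 - delta)) ^+ t.
Proof.
set rho := _ ^+ t; apply: contrapT => /forallNP no.
pose w (rv : {ffun 'I_t -> coinT}) := \prod_k pr (rv k).
have w0 rv : 0 <= w rv by exact: prodr_ge0.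
have w1 : \sum_rv w rv = 1.
  by rewrite -(bigA_distr_bigA (fun=> pr)) /= pr_sum1 prodr_const expr1n.
have : \sum_rv w rv * (\sum_(x | majority_err rv x) mu x) <= rho.
  under eq_bigr do rewrite big_mkcond mulr_sumr.
  rewrite exchange_big /= -[rho]mul1r -mu_sum1 mulr_suml.
  apply: ler_sum => x _.
  apply: le_trans (_ : mu x * \sum_(rv : {ffun 'I_t -> coinT} | majority_err rv x)
    w rv <= _); last by rewrite ler_wpM2l // majority_err_prob.
  rewrite mulr_sumr [leRHS]big_mkcond /=; apply: ler_sum => rv _.
  by case: ifP; rewrite ?mulr0 // mulrC.
apply/negP; rewrite -ltNge -[rho]mul1r -w1 mulr_suml.
have [rv wrv] : exists rv, 0 < w rv.
  apply: contrapT => /forallNP nw; have := oner_neq0 R; rewrite -w1 big1 ?eqxx // => rv _.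
  by apply/eqP; rewrite eq_le w0 andbT leNgt; apply/negP/nw.
rewrite (bigD1 rv) //= [ltRHS](bigD1 rv) //=; apply: ltr_leD.
  by rewrite ltr_pM2l // ltNge; apply/negP/no.
apply: ler_sum => rv' _; rewrite ler_wpM2l // ltW // ltNge; exact/negP/no.
Qed.

End Amplification.

(** * The information revealed by a union *)

Lemma natr_prod_forall (R : comNzRingType) (I : finType) (P : pred I) :
  [forall i, P i]%:R = \prod_i (P i)%:R :> R.
Proof.
have [/forallP Pi|/forallPn[i /negbTE Pi]] := boolP [forall i, P i].
  by rewrite big1 // => i _; rewrite Pi.
by rewrite (bigD1 i) //= Pi mul0r.
Qed.

(* The constant 4 comes from the tangent of [exp (8 - 2 t)] at [t = 4]. *)
Lemma prod_onem_ge (R : realType) (I : finType) (p : I -> R) (tau : R) :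
  (forall i, 0 <= p i <= 1) -> tau <= 2^-1 ->
  expR (- 8) * (9 - 2 * \sum_i p i) - 2 * \sum_(i | tau <= p i) p i
    <= \prod_i (1 - p i).
Proof.
move=> p01 tau2; set t := \sum_i _; set b := \sum_(i | _) _.
have p0 i : 0 <= p i by case/andP: (p01 i).
have p1 i : p i <= 1 by case/andP: (p01 i).
have t0 : 0 <= t by apply: sumr_ge0.
have b0 : 0 <= b by apply: sumr_ge0.
have k0 : 0 < expR (- 8) :> R := expR_gt0 _.
(* For [b > 1/2] the left side is at most 0; otherwise every [p i] is at most 1/2. *)
have [b2|b2] := leP b 2^-1; last first.
  apply: (@le_trans _ _ 0); last by apply: prodr_ge0 => i _; rewrite subr_ge0.
  have k9 : 9 * expR (- 8) <= 1 :> R.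
    rewrite expRN ler_pdivrMr ?expR_gt0 // mul1r.
    by apply: le_trans (expR_ge1Dx _); lra.
  by nra.
have ph i : p i <= 2^-1.
  have [ti|ti] := leP tau (p i); last by apply: le_trans (ltW ti) _.
  apply: le_trans b2; rewrite /b (bigD1 i) //= lerDl.
  by apply: sumr_ge0.
apply: (@le_trans _ _ (expR (- 2 * t))).
  have -> : - 2 * t = - 8 + (8 - 2 * t) by ring.
  rewrite expRD; have : 9 - 2 * t <= expR (8 - 2 * t).
    by apply: le_trans (expR_ge1Dx _); lra.
  by nra.
rewrite mulr_sumr expR_sum; apply: ler_prod => i _; rewrite expR_ge0 /=.
have [p0i phi] := (p0 i, ph i).
(* For [p <= 1/2], [1 <= (1 + 2 p) (1 - p)] gives [exp (- 2 p) <= 1 - p]. *)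
rewrite mulNr expRN invf_ple ?posrE ?expR_gt0 //; last by lra.
apply: le_trans (expR_ge1Dx _); rewrite -[X in X <= _]mul1r ler_pdivrMr; last by lra.
by nra.
Qed.

Section UnionInformation.
Variables (R : realType) (s : nat) (T L : finType) (F : {set T}).
Variables (D : {ffun 'I_s -> {set T}} -> L).
Variables (rect : L -> 'I_s -> {set T} -> bool) (out : L -> {set T}).
Hypothesis D_rect : forall x l, (D x == l) = [forall i, rect l i (x i)].
Hypothesis s_large : 4 <= ln s%:R :> R.

Implicit Types (x : {ffun 'I_s -> {set T}}) (A : {set T}) (l : L) (i : 'I_s)
  (j : T).

(** [sigma] is the square root of s. [kappa] is both the tolerated error and the constant of
    [prod_onem_ge]. *)
Let sigma : R := expR (ln s%:R / 2).
Let tau : R := sigma^-1.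
Let theta : R := s%:R^-1.
Let kappa : R := expR (- 8).
Let alpha j : R := if j \in F then theta else 0.

(** * The random input, independent over sites and elements *)

Definition set_weight A : R :=
  \prod_j (if j \in A then alpha j else 1 - alpha j).

Definition input_weight x : R := \prod_i set_weight (x i).

Let s_gt0 : 0 < s%:R :> R.
Proof.
rewrite ltNge; apply/negP => s0.
by have := s_large; rewrite ln0 //; lra.
Qed.

Let sigma_sqr : sigma * sigma = s%:R.
Proof. by rewrite -expRD -splitr lnK. Qed.

Let tau_bounds : 0 < tau /\ tau <= 2^-1.
Proof.
split; first by rewrite invr_gt0 expR_gt0.
rewrite lef_pV2 ?posrE ?expR_gt0 //.
by apply: le_trans (expR_ge1Dx _); have := s_large; lra.
Qed.

Let theta_sigma : theta * sigma = tau.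
Proof. by rewrite /theta -sigma_sqr invfM mulfVK // gt_eqF // expR_gt0. Qed.

Let theta_bounds : 0 <= theta /\ theta <= 1.
Proof.
have [t0 t1] := tau_bounds.
have -> : theta = tau * tau by rewrite /tau -invfM sigma_sqr.
by split; nra.
Qed.

Let alpha_bounds j : 0 <= alpha j /\ alpha j <= 1.
Proof. by rewrite /alpha; case: ifP. Qed.

Lemma set_weight_ge0 A : 0 <= set_weight A.
Proof.
by apply: prodr_ge0 => j _; have [a0 a1] := alpha_bounds j; case: ifP; lra.
Qed.

Lemma input_weight_ge0 x : 0 <= input_weight x.
Proof. by apply: prodr_ge0 => i _; exact: set_weight_ge0. Qed.

Lemma input_weight_eq0 x : ~~ [forall i, x i \subset F] -> input_weight x = 0.
Proof.
case/forallPn => i /fintype.subsetPn[j jx jF].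
rewrite /input_weight (bigD1 i) //= /set_weight (bigD1 j) //= jx.
by rewrite /alpha (negbTE jF) !mul0r.
Qed.

Lemma sum_set_weight_prod (phi : T -> bool -> R) :
  \sum_A set_weight A * \prod_j phi j (j \in A) =
  \prod_j (alpha j * phi j true + (1 - alpha j) * phi j false).
Proof.
rewrite bigA_distr; apply: eq_bigr => A _.
by rewrite -big_split; apply: eq_bigr => j _; case: ifP.
Qed.

Lemma sum_set_weight : \sum_A set_weight A = 1.
Proof.
transitivity (\sum_A set_weight A * \prod_(j : T) 1).
  by apply: eq_bigr => A _; rewrite big1 ?mulr1.
rewrite (sum_set_weight_prod (fun _ _ => 1)) big1 // => j _.
by rewrite !mulr1 subrKC.
Qed.

Lemma sum_set_weight_mem j : j \in F ->
  \sum_A set_weight A * (j \in A)%:R = theta.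
Proof.
move=> jF; pose phi k (b : bool) : R := if k == j then b%:R else 1.
transitivity (\sum_A set_weight A * \prod_k phi k (k \in A)).
  apply: eq_bigr => A _; rewrite (bigD1 j) //= big1 ?mulr1 /phi ?eqxx //.
  by move=> k /negbTE ->.
rewrite sum_set_weight_prod (bigD1 j) //= big1 /phi.
  by rewrite eqxx /alpha jF !(mulr1, mulr0, addr0).
by move=> k /negbTE ->; rewrite !mulr1 subrKC.
Qed.

Lemma sum_input_weight_prod (psi : 'I_s -> {set T} -> R) :
  \sum_x input_weight x * \prod_i psi i (x i) =
  \prod_i \sum_A set_weight A * psi i A.
Proof.
by rewrite bigA_distr_bigA; apply: eq_bigr => x _; rewrite -big_split.
Qed.

Lemma sum_input_weight : \sum_x input_weight x = 1.
Proof.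
rewrite -(bigA_distr_bigA (fun=> set_weight)) /=.
by rewrite sum_set_weight prodr_const expr1n.
Qed.

(* [Q l i], [P l i j] and [p l i j]: the probabilities that the input of site i
   is compatible with l, that moreover it contains j, and the conditional
   probability of the latter. *)
Let Q l i : R := \sum_A set_weight A * (rect l i A)%:R.
Let P l i j : R := \sum_A set_weight A * (rect l i A && (j \in A))%:R.
Let q l : R := \prod_i Q l i.
Let p l i j : R := P l i j / Q l i.

Let Q_ge0 l i : 0 <= Q l i.
Proof. by apply: sumr_ge0 => A _; rewrite mulr_ge0 ?set_weight_ge0. Qed.

Let P_ge0 l i j : 0 <= P l i j.
Proof. by apply: sumr_ge0 => A _; rewrite mulr_ge0 ?set_weight_ge0. Qed.

Let P_le_Q l i j : P l i j <= Q l i.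
Proof.
apply: ler_sum => A _; rewrite ler_wpM2l ?set_weight_ge0 //.
by case: rect; case: (_ \in _).
Qed.

Let p_bounds l i j : 0 <= p l i j <= 1.
Proof.
rewrite divr_ge0 //=; have := Q_ge0 l i; rewrite le_eqVlt => /orP[/eqP E|Q0].
  by rewrite /p -E invr0 mulr0.
by rewrite ler_pdivrMr // mul1r.
Qed.

(** If [Q l i] is 0, then [p l i j] is 0 by the convention for division, and [P l i j] is squeezed
    to 0. *)
Let QpE l i j : Q l i * p l i j = P l i j.
Proof.
rewrite /p mulrC; have [Q0|Q0] := eqVneq (Q l i) 0; last by rewrite mulfVK.
have := P_le_Q l i j; have := P_ge0 l i j; rewrite Q0 mulr0.
by move=> ? ?; apply/eqP; rewrite eq_le; apply/andP.
Qed.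

Let q_ge0 l : 0 <= q l.
Proof. exact: prodr_ge0. Qed.

(** The rectangle property factors the indicator of a leaf over the sites, which thus stay
    independent given [l]. *)
Let sum_leaf_prod l (psi : 'I_s -> {set T} -> R) :
  \sum_(x | D x == l) input_weight x * \prod_i psi i (x i) =
  \prod_i \sum_A set_weight A * ((rect l i A)%:R * psi i A).
Proof.
rewrite -sum_input_weight_prod big_mkcond; apply: eq_bigr => x _.
rewrite big_split /= -natr_prod_forall -D_rect.
by case: ifP; rewrite ?mul1r // mul0r mulr0.
Qed.

Let leaf_weight l : \sum_(x | D x == l) input_weight x = q l.
Proof.
transitivity (\sum_(x | D x == l) input_weight x * \prod_(i < s) 1).
  by apply: eq_bigr => x _; rewrite big1 ?mulr1.
rewrite (sum_leaf_prod l (fun _ _ => 1)); apply: eq_bigr => i _.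
by apply: eq_bigr => A _; rewrite mulr1.
Qed.

Let leaf_mem l i j :
  \sum_(x | D x == l) input_weight x * (j \in x i)%:R = q l * p l i j.
Proof.
pose psi k A : R := if k == i then (j \in A)%:R else 1.
transitivity (\sum_(x | D x == l) input_weight x * \prod_k psi k (x k)).
  apply: eq_bigr => x _; rewrite (bigD1 i) //= big1 ?mulr1 /psi ?eqxx //.
  by move=> k /negbTE ->.
rewrite sum_leaf_prod /q (bigD1 i) //= [in RHS](bigD1 i) //= mulrAC QpE.
congr (_ * _); last first.
  apply: eq_bigr => k /negbTE ki; apply: eq_bigr => A _.
  by rewrite /psi ki mulr1.
by apply: eq_bigr => A _; rewrite /psi eqxx -natrM mulnb.
Qed.

Let notin_bigcup_natr j x :
  (j \notin \bigcup_i x i)%SET%:R = \prod_i (j \notin x i)%:R :> R.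
Proof.
rewrite -natr_prod_forall; congr (nat_of_bool _)%:R.
apply/idP/forallP => [h i|h]; last by apply/bigcupP => -[i _]; apply/negP/h.
by apply: contra h => jx; apply/bigcupP; exists i.
Qed.

Let leaf_notin l j :
  \sum_(x | D x == l) input_weight x * (j \notin \bigcup_i x i)%SET%:R =
  q l * \prod_i (1 - p l i j).
Proof.
under [LHS]eq_bigr do rewrite notin_bigcup_natr.
rewrite (sum_leaf_prod l (fun _ A => (j \notin A)%:R)) -big_split /=.
apply: eq_bigr => i _; rewrite mulrBr mulr1 QpE -sumrB.
apply: eq_bigr => A _; rewrite -mulrBr; congr (_ * _).
by case: rect; case: (_ \in _); rewrite /= ?(mulr0, mulr1, subr0, subrr).
Qed.

Let sum_leaves (f : {ffun 'I_s -> {set T}} -> R) :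
  \sum_x f x = \sum_l \sum_(x | D x == l) f x.
Proof. exact: partition_big. Qed.

Let big_mass l j : R := \sum_(i | tau <= p l i j) p l i j.

Hypothesis out_err :
  \sum_(x | out (D x) != (\bigcup_i x i)%SET) input_weight x <= kappa.

(** Summing over the leaves undoes the conditioning; each of the s sites holds j with probability
    1/s. *)
Let expected_owners j : j \in F -> \sum_l q l * \sum_i p l i j = 1.
Proof.
move=> jF; transitivity (\sum_(i < s) theta).
  under eq_bigr do rewrite mulr_sumr.
  rewrite exchange_big; apply: eq_bigr => i _ /=.
  under eq_bigr do rewrite -leaf_mem.
  rewrite -sum_leaves -(sum_set_weight_mem jF).
  pose psi k A : R := if k == i then (j \in A)%:R else 1.
  transitivity (\sum_x input_weight x * \prod_k psi k (x k)).
    apply: eq_bigr => x _; rewrite (bigD1 i) //= big1 ?mulr1 /psi ?eqxx //.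
    by move=> k /negbTE ->.
  rewrite sum_input_weight_prod (bigD1 i) //= [X in _ * X]big1 ?mulr1.
    by apply: eq_bigr => A _; rewrite /psi eqxx.
  move=> k /negbTE ki; rewrite -[RHS]sum_set_weight.
  by apply: eq_bigr => A _; rewrite /psi ki mulr1.
by rewrite sumr_const card_ord -[theta *+ s]mulr_natl mulfV // gt_eqF.
Qed.

(** The weight is [(1 - 1/s)^s <= exp (- 1) <= 1/2]. *)
Let unowned_weight j : j \in F ->
  \sum_x input_weight x * (j \notin \bigcup_i x i)%SET%:R <= 2^-1.
Proof.
move=> jF; under eq_bigr do rewrite notin_bigcup_natr.
rewrite (sum_input_weight_prod (fun _ A => (j \notin A)%:R)).
have E : \sum_A set_weight A * (j \notin A)%:R = 1 - theta.
  rewrite -(sum_set_weight_mem jF) -[X in _ = X - _]sum_set_weight -sumrB.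
  apply: eq_bigr => A _; rewrite -[X in X - _]mulr1 -mulrBr; congr (_ * _).
  by case: (_ \in _); rewrite ?subr0 ?subrr.
rewrite E prodr_const card_ord.
have [t0 t1] := theta_bounds.
apply: (@le_trans _ _ (expR (- theta) ^+ s)).
  rewrite lerXn2r ?nnegrE ?expR_ge0 ?subr_ge0 //.
  exact: expR_ge1Dx.
rewrite -expRM_natl mulrN mulfV ?gt_eqF // expRN lef_pV2 ?posrE ?expR_gt0 //.
by apply: le_trans (expR_ge1Dx _); lra.
Qed.

Let kappa_bounds : 0 < kappa /\ 9 * kappa <= 1.
Proof.
split; first exact: expR_gt0.
rewrite /kappa expRN ler_pdivrMr ?expR_gt0 // mul1r.
by apply: le_trans (expR_ge1Dx _); lra.
Qed.

Let expected_big_mass j : j \in F -> kappa / 4 <= \sum_l q l * big_mass l j.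
Proof.
move=> jF.
have [k0 k9] := kappa_bounds.
have unowned := unowned_weight jF.
have owners := expected_owners jF.
(* Every input lacks j in its union, reaches a leaf reporting j, or is answered wrongly. *)
have S1 : 1 <= \sum_x input_weight x * (j \notin \bigcup_i x i)%SET%:R +
    \sum_(l | j \in out l) q l + kappa.
  have -> : \sum_(l | j \in out l) q l =
      \sum_x input_weight x * (j \in out (D x))%:R.
    rewrite sum_leaves big_mkcond; apply: eq_bigr => l _.
    rewrite -leaf_weight; case: ifP => jl.
      by apply: eq_bigr => x /eqP ->; rewrite jl mulr1.
    by rewrite big1 // => x /eqP ->; rewrite jl mulr0.
  rewrite -[X in X <= _]sum_input_weight.
  apply: le_trans (lerD (lexx _) out_err).
  rewrite [X in _ <= _ + X]big_mkcond -!big_split /=; apply: ler_sum => x _.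
  have := input_weight_ge0 x.
  case: eqVneq => [->|_].
    by case: (j \in _); rewrite /= ?(mulr0, mulr1); lra.
  by case: (j \in _); case: (j \in out _); rewrite /= ?(mulr0, mulr1); lra.
have S2 : \sum_(l | j \in out l) q l * \prod_i (1 - p l i j) <= kappa.
  apply: le_trans out_err; rewrite [leRHS]big_mkcond sum_leaves.
  rewrite big_mkcond; apply: ler_sum => l _; case: ifP => jl; last first.
    by apply: sumr_ge0 => x _; case: ifP => // _; exact: input_weight_ge0.
  rewrite -leaf_notin; apply: ler_sum => x /eqP ->.
  case: eqVneq => [<-|_]; first by rewrite jl mulr0.
  by rewrite ler_piMr ?input_weight_ge0 //; case: (_ \in _).
(* [prod_onem_ge] is averaged over the leaves reporting j; the subtracted sums only grow when
   extended to all leaves. *)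
have S3 : 9 * kappa * \sum_(l | j \in out l) q l -
    2 * kappa * \sum_l q l * \sum_i p l i j - 2 * \sum_l q l * big_mass l j
    <= kappa.
  apply: le_trans S2.
  apply: (@le_trans _ _ (\sum_(l | j \in out l)
    (9 * kappa * q l - 2 * kappa * (q l * \sum_i p l i j)
      - 2 * (q l * big_mass l j)))).
    rewrite !sumrB -!mulr_sumr.
    apply: lerB; first apply: lerB => //.
      rewrite ler_wpM2l //; first by lra.
      rewrite [leLHS]big_mkcond; apply: ler_sum => l _; case: ifP => // _.
      rewrite mulr_ge0 //; apply: sumr_ge0 => i _.
      by case/andP: (p_bounds l i j).
    rewrite ler_wpM2l // [leLHS]big_mkcond; apply: ler_sum => l _.
    case: ifP => // _; rewrite mulr_ge0 //; apply: sumr_ge0 => i _.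
    by case/andP: (p_bounds l i j).
  apply: ler_sum => l _.
  have [_ tau2] := tau_bounds.
  have := prod_onem_ge (fun i => p_bounds l i j) tau2.
  move=> /(ler_wpM2l (q_ge0 l)); apply: le_trans.
  by rewrite le_eqVlt; apply/orP; left; apply/eqP; rewrite /big_mass /kappa; ring.
rewrite owners in S3.
set a := \sum_x _ in unowned S1; set b := \sum_(l | _) _ in S1 S3.
set c := \sum_l _ in S3 *.
(* [S3] then gives [2 c >= 9 kappa (1/2 - kappa) - 3 kappa >= kappa / 2], as [9 kappa <= 1]. *)
have b1 : 2^-1 - kappa <= b by lra.
by nra.
Qed.

(* Each factor is at most [(1 + tau) exp (- tau)], because raising [theta] by the
   factor [sigma] gives [tau]. *)
Let expected_exp_le l :
  \sum_x input_weight x *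
    expR (\sum_i \sum_(j in F | tau <= p l i j)
      ((j \in x i)%:R * (ln s%:R / 2) - tau)) <= 1.
Proof.
pose phi i j (b : bool) : R := if (j \in F) && (tau <= p l i j)
  then expR (b%:R * (ln s%:R / 2) - tau) else 1.
rewrite (_ : \sum_x _ =
  \sum_x input_weight x * \prod_i \prod_j phi i j (j \in x i)); last first.
  apply: eq_bigr => x _; congr (_ * _); rewrite expR_sum; apply: eq_bigr => i _.
  by rewrite expR_sum big_mkcond.
rewrite (sum_input_weight_prod (fun i A => \prod_j phi i j (j \in A))).
have phi0 i j b : 0 <= phi i j b by rewrite /phi; case: ifP; rewrite ?expR_ge0.
apply: prodr_ile1 => i _; rewrite sum_set_weight_prod.
rewrite prodr_ge0 /=; last first.
  move=> j _; have [a0 a1] := alpha_bounds j.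
  by rewrite addr_ge0 // mulr_ge0 // subr_ge0.
apply: prodr_ile1 => j _; have [a0 a1] := alpha_bounds j.
rewrite addr_ge0 ?mulr_ge0 ?subr_ge0 //=.
rewrite /phi; case: ifP => [/andP[jF _]|_]; last by rewrite !mulr1 subrKC.
have [t0 t1] := tau_bounds; have [th0 th1] := theta_bounds.
rewrite /alpha jF mul1r mul0r sub0r expRD -/sigma mulrA theta_sigma -mulrDl.
rewrite expRN ler_pdivrMr ?expR_gt0 // mul1r.
by apply: le_trans (expR_ge1Dx _); lra.
Qed.

(** The exponential of [g l] has mean at most 1 for each fixed leaf, so at most |L| at the leaf
    actually reached. Hence [g] has mean at most ln |L|, while [expected_big_mass] bounds this mean
    from below. *)
Lemma union_information : kappa / 16 * (#|F|%:R * ln s%:R) <= ln #|L|%:R :> R.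
Proof.
pose g l x : R := \sum_i \sum_(j in F | tau <= p l i j)
  ((j \in x i)%:R * (ln s%:R / 2) - tau).
have expg : \sum_x input_weight x * expR (g (D x) x) <= #|L|%:R.
  rewrite -sum1_card natr_sum sum_leaves; apply: ler_sum => l _.
  apply: le_trans (expected_exp_le l).
  rewrite [leLHS]big_mkcond; apply: ler_sum => x _; case: eqP => [-> //|_].
  by rewrite mulr_ge0 ?input_weight_ge0 ?expR_ge0.
have L_gt0 : 0 < #|L|%:R :> R.
  rewrite ltr0n; apply/card_gt0P; exists (D [ffun=> finset.set0]) => //.
(* Jensen's inequality through the tangent [g <= exp g / |L| + ln |L| - 1]. *)
have jensen : \sum_x input_weight x * g (D x) x <= ln #|L|%:R.
  apply: (@le_trans _ _ (\sum_x input_weight x *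
      (expR (g (D x) x) * #|L|%:R^-1 + (ln #|L|%:R - 1)))).
    apply: ler_sum => x _; rewrite ler_wpM2l ?input_weight_ge0 //.
    have := expR_ge1Dx (g (D x) x - ln #|L|%:R).
    by rewrite expRD expRN lnK ?posrE //; lra.
  under eq_bigr do rewrite mulrDr mulrA.
  rewrite big_split /= -!mulr_suml sum_input_weight mul1r.
  have : (\sum_x input_weight x * expR (g (D x) x)) / #|L|%:R <= 1.
    by rewrite ler_pdivrMr // mul1r.
  by lra.
apply: le_trans jensen.
rewrite sum_leaves.
have -> : \sum_l \sum_(x | D x == l) input_weight x * g (D x) x =
    \sum_l \sum_i \sum_(j in F | tau <= p l i j)
      (q l * p l i j * (ln s%:R / 2) - q l * tau).
  apply: eq_bigr => l _.
  rewrite (eq_bigr (fun x => input_weight x * g l x)); last by move=> x /eqP ->.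
  under eq_bigr do rewrite mulr_sumr.
  rewrite exchange_big; apply: eq_bigr => i _ /=.
  under eq_bigr do rewrite mulr_sumr.
  rewrite exchange_big; apply: eq_bigr => j _ /=.
  under eq_bigr do rewrite mulrBr [X in X - _]mulrA.
  by rewrite sumrB -!mulr_suml leaf_mem leaf_weight.
(* From [tau <= p] and [4 <= ln s]: [p * (ln s / 2) - tau >= p * (ln s / 2 - 1) >= p * (ln s /
   4)]. *)
apply: (@le_trans _ _ ((\sum_l \sum_i \sum_(j in F | tau <= p l i j)
      q l * p l i j) * (ln s%:R / 4))); last first.
  rewrite mulr_suml; apply: ler_sum => l _.
  rewrite mulr_suml; apply: ler_sum => i _.
  rewrite mulr_suml; apply: ler_sum => j /andP[_ tp].
  have := s_large; have q0 := q_ge0 l; have [t0 _] := tau_bounds => s4.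
  rewrite -[X in X <= _]mulrA -[X in _ <= X - _]mulrA -mulrBr ler_wpM2l //.
  by nra.
rewrite [X in _ <= X * _](_ : _ = \sum_(j in F) \sum_l q l * big_mass l j).
  have : #|F|%:R * (kappa / 4) <= \sum_(j in F) \sum_l q l * big_mass l j.
    rewrite mulr_natl -sumr_const; apply: ler_sum => j; exact: expected_big_mass.
  move=> h; have := s_large => s4.
  apply: le_trans (ler_wpM2r _ h); last by lra.
  by rewrite le_eqVlt; apply/orP; left; apply/eqP; field.
rewrite [RHS]exchange_big /=; apply: eq_bigr => l _.
rewrite (exchange_big_dep (fun j => j \in F)) /=; last by move=> ? ? _ /andP[].
apply: eq_bigr => j jF; rewrite /big_mass mulr_sumr.
by apply: eq_bigl => i; rewrite jF.
Qed.

End UnionInformation.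

(** * Protocols computing a union *)

Section UnionProtocol.
Variables (R : realType) (s : nat) (T : finType) (F : {set T}) (delta : R).
Variable task : {ffun 'I_s -> {set T}} -> {set T} -> Prop.
Hypothesis task_union : forall (x : {ffun 'I_s -> {set T}}) H,
  (forall i, x i \subset F) -> task x H ->
  H = (\bigcup_i x i)%SET.
Hypotheses (delta_gt0 : 0 < delta) (delta_lt_half : delta < 2^-1).
Variable P : protocol R s {set T} {set T}.
Hypothesis P_solves : solves delta task P.

Implicit Types (x : {ffun 'I_s -> {set T}}) (r : coins P).

Let err r x : bool := ~~ `[< task x (run (strategy r) x) >].

Let run_union r x : (forall i, x i \subset F) -> ~~ err r x ->
  run (strategy r) x = (\bigcup_i x i)%SET.
Proof. by move=> xF /negPn/asboolP; exact: task_union. Qed.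

Let bits_le_cost r x : (bits (strategy r) x <= cost P)%N.
Proof.
apply: leq_trans (leq_bigmax r).
exact: (leq_bigmax (F := fun y : {ffun 'I_s -> {set T}} => bits (strategy r) y)).
Qed.

Let err_prob x : \sum_(r | err r x) coin_prob r <= delta.
Proof.
have := P_solves x; rewrite /success_prob.
have := coin_prob_sum1 P; rewrite (bigID (err^~ x)) /=.
rewrite [X in _ + X](eq_bigl (fun r => `[< task x (run (strategy r) x) >]));
  last by move=> r; rewrite /err negbK.
by move=> ? ?; lra.
Qed.

Let singleton_input (i : 'I_s) (A : {set T}) : {ffun 'I_s -> {set T}} :=
  [ffun k => if k == i then A else finset.set0].

Let singleton_input_union i A : (\bigcup_k singleton_input i A k)%SET = A.
Proof.
rewrite (bigD1 i) //= big1 ?ffunE ?eqxx ?finset.setU0 //.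
by move=> k /negbTE ki; rewrite ffunE ki.
Qed.

Let singleton_input_sub i (A : {set T}) : A \subset F ->
  forall k, singleton_input i A k \subset F.
Proof. by move=> AF k; rewrite ffunE; case: ifP => // _; exact: finset.sub0set. Qed.

(* A site that stays silent on the empty input cannot signal its only edge. *)
Lemma cost_ge_sites : (0 < #|F|)%N -> (1 - 2 * delta) * s%:R <= (cost P)%:R.
Proof.
case/card_gt0P => e eF.
pose x0 : {ffun 'I_s -> {set T}} := [ffun=> finset.set0].
have x0F i : x0 i \subset F by rewrite ffunE finset.sub0set.
have eF1 : [set e]%SET \subset F by rewrite finset.sub1set.
pose spk r i := speaks (strategy r) x0 i.
have one i : 1 - 2 * delta <= \sum_r coin_prob r * (spk r i)%:R.
  pose xi := singleton_input i [set e]%SET.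
  (* If site i is silent on [x0] and both answers are right, the outputs agree although the unions
     differ. *)
  have pt r : coin_prob r * (1 - (err r x0)%:R - (err r xi)%:R) <=
      coin_prob r * (spk r i)%:R.
    rewrite ler_wpM2l ?coin_prob_ge0 //.
    case s_r: (spk r i); first by case: (err r x0); case: (err r xi) => /=; lra.
    case e0: (err r x0); first by case: (err r xi) => /=; lra.
    case e1: (err r xi); first by rewrite /=; lra.
    have := run_union x0F (negbT e0).
    rewrite -(run_silent (x' := xi) (negbT s_r)); last first.
      by move=> j /negbTE ji; rewrite !ffunE ji.
    rewrite (run_union (singleton_input_sub i eF1) (negbT e1)).
    rewrite singleton_input_union big1; last by move=> k _; rewrite ffunE.
    by move=> /setP /(_ e); rewrite !inE eqxx.
  apply: le_trans (ler_sum _ (fun r _ => pt r)).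
  under eq_bigr do rewrite !mulrBr mulr1.
  rewrite !sumrB coin_prob_sum1.
  have errE x : \sum_r coin_prob r * (err r x)%:R = \sum_(r | err r x) coin_prob r.
    rewrite [RHS]big_mkcond; apply: eq_bigr => r _.
    by case: (err r x); rewrite ?mulr1 ?mulr0.
  by rewrite !errE; have := err_prob x0; have := err_prob xi; lra.
apply: (@le_trans _ _ (\sum_(i < s) \sum_r coin_prob r * (spk r i)%:R)).
  by rewrite mulr_natr -[X in _ *+ X](card_ord s) -sumr_const ler_sum.
rewrite exchange_big /= -[leRHS]mul1r -[X in X * _](coin_prob_sum1 P) mulr_suml.
apply: ler_sum => r _; rewrite -mulr_sumr ler_wpM2l ?coin_prob_ge0 //.
rewrite -natr_sum ler_nat (leq_trans _ (bits_le_cost r x0)) //.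
rewrite (leq_trans _ (card_speakers _ x0)) // -sum1_card [leqRHS]big_mkcond.
by apply: leq_sum => i _; rewrite inE /spk; case: speaks.
Qed.

(** Some coin is right on at least half of the subsets of F given to [i0] alone. There the
    transcript determines the subset, so [2 ^ |F| <= 2 * 2 ^ C]. *)
Lemma card_le_2cost (i0 : 'I_s) : (#|F| <= 2 * cost P)%N.
Proof.
have [->//|F0] := posnP #|F|.
pose x A := singleton_input i0 A.
have [r good_r] : exists r, (2 ^ #|F| <= 2 *
    #|[set A in powerset F | ~~ err r (x A)]%SET|)%N.
  apply: contrapT => /forallNP no.
  pose S : R := \sum_r coin_prob r * (2 * #|[set A in powerset F | ~~ err r (x A)]%SET|)%:R.
  have S_lt : S < (2 ^ #|F|)%:R.
    rewrite /S -[ltRHS]mul1r -[X in X * _](coin_prob_sum1 P) mulr_suml.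
    have le_r r : coin_prob r * (2 * #|[set A in powerset F | ~~ err r (x A)]%SET|)%:R <=
        coin_prob r * (2 ^ #|F|)%:R.
      rewrite ler_wpM2l ?coin_prob_ge0 // ler_nat ltnW //.
      by rewrite ltnNge; apply/negP/no.
    have [r r0] : exists r, 0 < coin_prob r.
      apply: contrapT => /forallNP nw; have := oner_neq0 R.
      rewrite -[X in X != _](coin_prob_sum1 P) big1 ?eqxx // => r _.
      by apply/eqP; rewrite eq_le coin_prob_ge0 andbT leNgt; apply/negP/nw.
    rewrite (bigD1 r) //= [ltRHS](bigD1 r) //=; apply: ltr_leD; last exact: ler_sum.
    by rewrite ltr_pM2l // ltr_nat ltnNge; apply/negP/no.
  have S_ge : (2 ^ #|F|)%:R <= S.
    rewrite /S.
    have -> : \sum_r coin_prob r * (2 * #|[set A in powerset F | ~~ err r (x A)]%SET|)%:R =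
        2 * \sum_(A in powerset F) \sum_(r | ~~ err r (x A)) coin_prob r.
      rewrite (exchange_big_dep xpredT) //= mulr_sumr; apply: eq_bigr => r _.
      rewrite natrM mulrCA mulr_natr sumr_const; congr (_ * (_ *+ _)).
      by apply: eq_card => A; rewrite [RHS]unfold_in !inE.
    have -> : (2 ^ #|F|)%:R = #|powerset F|%:R :> R by rewrite card_powerset.
    rewrite -sum1_card natr_sum mulr_sumr; apply: ler_sum => A _.
    have := coin_prob_sum1 P; rewrite (bigID (err^~ (x A))) /=.
    by have := delta_lt_half; have := err_prob (x A); lra.
  by have := lt_le_trans S_lt S_ge; rewrite ltxx.
pose C := cost P.
pose tr A : C.-tuple bool := Tuple (size_transcript C (strategy r) (x A)).
have inj_tr : {in [set A in powerset F | ~~ err r (x A)]%SET &, injective tr}.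
  have dec A : A \in [set A in powerset F | ~~ err r (x A)]%SET ->
      transcript_output finset.set0 (strategy r) (tr A) = A.
    rewrite !inE => /andP[AF nerr].
    rewrite transcript_outputE ?bits_le_cost // run_union ?singleton_input_union //.
    exact: singleton_input_sub.
  by move=> A B hA hB E; rewrite -[A]dec // E dec.
have := max_card [set tr A | A in [set A in powerset F | ~~ err r (x A)]]%SET.
rewrite card_in_imset // card_tuple card_bool => le_C.
have : (2 ^ #|F| <= 2 ^ C.+1)%N by rewrite expnS (leq_trans good_r) // leq_mul2l.
rewrite leq_exp2l // => FC.
(* A positive cost turns [|F| <= C + 1] into [|F| <= 2 C]. *)
have C0 : (0 < C)%N.
  rewrite -(ltr0n R); apply: lt_le_trans (cost_ge_sites F0).
  apply: mulr_gt0; first by have := delta_lt_half; lra.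
  by rewrite ltr0n (leq_ltn_trans _ (ltn_ord i0)).
by rewrite -/C; lia.
Qed.

(** The t transcripts for fixed coins form one leaf, decoded by majority vote, to which
    [union_information] applies. *)
Lemma cost_ge_information t :
  (2^-1 + 2 * delta * (1 - delta)) ^+ t <= expR (- 8) ->
  4 <= ln s%:R :> R ->
  expR (- 8) / 16 * (#|F|%:R * ln s%:R) <= t%:R * (cost P)%:R :> R.
Proof.
move=> t_large s_large.
have i0 : 'I_s.
  have : (0 < s)%N; last by case: (s) => // n _; exact: ord0.
  rewrite lt0n; apply/negP => /eqP s0.
  by move: s_large; rewrite s0 ln0 //; lra.
pose C := cost P.
have [rv rv_err] := derandomized_majority (@coin_prob_ge0 _ _ _ _ P)
  (coin_prob_sum1 P) (fun x => input_weight_ge0 F s_large x)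
  (sum_input_weight R s F) delta_gt0 delta_lt_half err_prob t.
pose L : finType := {ffun 'I_t -> C.-tuple bool}.
pose D x : L := [ffun k => Tuple (size_transcript C (strategy (rv k)) x)].
pose rect (l : L) i A := [forall k, compatible (strategy (rv k)) (l k) i A].
pose votes (l : L) (Y : {set T}) :=
  #|[pred k | transcript_output finset.set0 (strategy (rv k)) (l k) == Y]|.
pose out (l : L) : {set T} :=
  odflt finset.set0 [pick Y | (t < 2 * votes l Y)%N].
have D_rect x l : (D x == l) = [forall i, rect l i (x i)].
  apply/eqP/forallP => [<- i|h].
    apply/forallP => k; rewrite ffunE /=.
    have /esym := transcript_rectangle i0 (strategy (rv k)) x
      (eqP (size_transcript C (strategy (rv k)) x)).
    by rewrite eqxx => /forallP.
  apply/ffunP => k; rewrite ffunE; apply: val_inj => /=; apply/eqP.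
  rewrite (transcript_rectangle i0) ?size_tuple //; apply/forallP => i.
  exact: (forallP (h i)).
have out_union x : (forall i, x i \subset F) -> ~~ majority_err err rv x ->
    out (D x) = (\bigcup_i x i)%SET.
  move=> xF; rewrite /majority_err -ltnNge => few.
  have many : (t < 2 * votes (D x) (\bigcup_i x i)%SET)%N.
    have sub : (#|[predC [pred k | err (rv k) x]]| <=
        votes (D x) (\bigcup_i x i)%SET)%N.
      apply: subset_leq_card; apply/fintype.subsetP => k; rewrite !inE => nerr.
      by rewrite ffunE /= transcript_outputE ?bits_le_cost // run_union.
    have tE : (#|[pred k | err (rv k) x]| +
        #|[predC [pred k | err (rv k) x]]| = t)%N by rewrite cardC card_ord.
    by lia.
  rewrite /out; case: pickP => [Y manyY /=|/(_ (\bigcup_i x i)%SET)]; last first.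
    by rewrite many.
  (* Two different sets cannot both have a strict majority of the t votes. *)
  apply/eqP/negP => /negP neq.
  pose p1 := [pred k | transcript_output finset.set0 (strategy (rv k)) (D x k)
    == Y].
  pose p2 := [pred k | transcript_output finset.set0 (strategy (rv k)) (D x k)
    == (\bigcup_i x i)%SET].
  have UI : (#|[predU p1 & p2]| + #|[predI p1 & p2]| =
    votes (D x) Y + votes (D x) (\bigcup_i x i)%SET)%N := cardUI p1 p2.
  have I0 : #|[predI p1 & p2]| = 0%N.
    apply: eq_card0 => k; rewrite !inE; apply/negP => /andP[/eqP -> /eqP E].
    by rewrite E eqxx in neq.
  have Ut : (#|[predU p1 & p2]| <= t)%N by rewrite -[t in leqRHS]card_ord max_card.
  by lia.
have out_err : \sum_(x | out (D x) != (\bigcup_i x i)%SET)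
    input_weight R F x <= expR (- 8).
  apply: le_trans t_large; apply: le_trans rv_err.
  rewrite big_mkcond [leRHS]big_mkcond; apply: ler_sum => x _.
  have w0 := input_weight_ge0 F s_large x.
  case: ifP => neq; last by case: ifP.
  case: ifP => // /negbT nmaj.
  have [/forallP xF|nxF] := boolP [forall i, x i \subset F].
    by rewrite out_union // eqxx in neq.
  by rewrite input_weight_eq0.
apply: le_trans (union_information D_rect s_large out_err) _.
(* [ln |L| = C t ln 2], and [ln 2 <= 1]. *)
rewrite card_ffun card_tuple card_ord card_bool -expnM natrX lnXn // -/C.
rewrite -[_ *+ (C * t)]mulr_natr natrM [t%:R * _]mulrC ler_piMl // ?mulr_ge0 //.
have -> : 2 = 1 + 1 :> R by [].
exact: le_ln1Dx.
Qed.

End UnionProtocol.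

(** * Graphs without short cycles *)

(** Length 3 serves both spanners: for an edge, [1 + 2] and [3 * 1] agree. *)
Definition distance_rigid (n : nat) (F : {set edge n}) : Prop :=
  forall G H : {set edge n}, G \subset F -> H \subset G ->
    (forall u v, adj G u v -> exists p : seq 'I_n,
       [/\ (size p <= 3)%N, path (adj H) u p & last u p = v]) ->
    H = G.

Section IncidenceGraph.
Variables (n : nat) (A B : finType) (inc : A -> B -> bool).
Variable f : A + B -> 'I_n.
Hypothesis f_inj : injective f.
Hypothesis inc_C4free : forall p p' l l',
  inc p l -> inc p' l -> inc p l' -> inc p' l' -> p = p' \/ l = l'.

Lemma incidence_edge_card (pl : A * B) :
  #|[set f (inl pl.1); f (inr pl.2)]%SET| == 2%N.
Proof. by rewrite cards2 (inj_eq f_inj). Qed.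

Definition incidence_edge (pl : A * B) : edge n :=
  Sub [set f (inl pl.1); f (inr pl.2)]%SET (incidence_edge_card pl).

Definition incidence_graph : {set edge n} :=
  [set incidence_edge pl | pl in [pred pl : A * B | inc pl.1 pl.2]]%SET.

Lemma set2_bipartite_inj p l p' l' :
  [set f (inl p); f (inr l)]%SET = [set f (inl p'); f (inr l')]%SET ->
  p = p' /\ l = l'.
Proof.
move=> E; split.
  have: f (inl p) \in [set f (inl p'); f (inr l')]%SET by rewrite -E set21.
  by rewrite !inE !(inj_eq f_inj) orbF => /eqP[].
have: f (inr l) \in [set f (inl p'); f (inr l')]%SET by rewrite -E set22.
by rewrite !inE !(inj_eq f_inj) /= => /eqP[].
Qed.

Lemma card_incidence_graph :
  #|incidence_graph| = #|[pred pl : A * B | inc pl.1 pl.2]|.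
Proof.
apply: card_imset => -[p l] [p' l'] /(congr1 val) /=.
by move=> /set2_bipartite_inj[-> ->].
Qed.

Variable H : {set edge n}.
Hypothesis subH : H \subset incidence_graph.

Lemma adj_incidence u v : adj H u v -> exists p l,
  [/\ inc p l, incidence_edge (p, l) \in H &
      (u, v) = (f (inl p), f (inr l)) \/ (u, v) = (f (inr l), f (inl p))].
Proof.
move=> /existsP[e /andP[eH /eqP eE]].
have /imsetP[[p l] pl eQ] := fintype.subsetP subH _ eH.
exists p, l; rewrite -eQ; split=> //.
have E : [set u; v]%SET = [set f (inl p); f (inr l)]%SET by rewrite -eE eQ.
have cuv : u != v.
  by have := valP e; rewrite /= eE cards2; case: (u != v).
have := set21 u v; have := set22 u v; rewrite E !inE.
move=> /orP[]/eqP Ev /orP[]/eqP Eu; rewrite Eu Ev; [|by right|by left|].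
  by rewrite Eu Ev eqxx in cuv.
by rewrite Eu Ev eqxx in cuv.
Qed.

Lemma adj_inl p v : adj H (f (inl p)) v -> exists l,
  [/\ v = f (inr l), inc p l & incidence_edge (p, l) \in H].
Proof.
move=> /adj_incidence[p' [l [i h [[/f_inj[->] ->]|[/f_inj//]]]]].
by exists l.
Qed.

Lemma adj_inr l v : adj H (f (inr l)) v -> exists p,
  [/\ v = f (inl p), inc p l & incidence_edge (p, l) \in H].
Proof.
move=> /adj_incidence[p [l' [i h [[/f_inj//]|[/f_inj[->] ->]]]]].
by exists p.
Qed.

(** By bipartiteness the path has length 1 or 3. With length 3, the pair (p, l) would close a
    4-cycle unless it is the first or the last edge of the path. *)
Lemma incidence_short_path p l s : inc p l -> (size s <= 3)%N ->
  path (adj H) (f (inl p)) s -> last (f (inl p)) s = f (inr l) ->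
  incidence_edge (p, l) \in H.
Proof.
move=> ipl; case: s => [|u [|v [|w [|? ?]]]] //= _.
- by move=> _ /f_inj.
- by rewrite andbT => /adj_inl[l' [-> _ h]] /f_inj[<-].
- by move=> /and3P[/adj_inl[l' [-> _ _]] /adj_inr[p' [-> _ _]] _] /f_inj.
move=> /and4P[/adj_inl[l' [-> i1 h1]] /adj_inr[p' [-> i2 h2]]].
move=> /adj_inl[l'' [-> i3 h3]] _ /f_inj[E]; rewrite {}E in i3 h3.
by have [Ep|El] := inc_C4free ipl i3 i1 i2; [rewrite Ep|rewrite El].
Qed.

End IncidenceGraph.

Lemma incidence_graph_rigid n (A B : finType) (inc : A -> B -> bool) (f : A + B -> 'I_n)
    (f_inj : injective f) :
  (forall p p' l l',
    inc p l -> inc p' l -> inc p l' -> inc p' l' -> p = p' \/ l = l') ->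
  distance_rigid (incidence_graph inc f_inj).
Proof.
move=> C4 G H GF HG path3.
apply/eqP; rewrite finset.eqEsubset HG; apply/fintype.subsetP => e eG.
have /imsetP[[p l] ipl eQ] := fintype.subsetP GF _ eG.
have [|s [s3 ps ls]] := path3 (f (inl p)) (f (inr l)).
  by apply/existsP; exists e; rewrite eG eQ /=.
have HF := fintype.subset_trans HG GF.
by rewrite eQ; exact: (incidence_short_path C4 HF ipl s3 ps ls).
Qed.

(** The point (x, y) lies on the line (a, b) when y = a x + b. Two points on two common lines
    satisfy (a - a') (x - x') = 0. *)
Lemma affine_plane_graph (K : finFieldType) n : (2 * #|K| ^ 2 <= n)%N ->
  exists F : {set edge n}, distance_rigid F /\ #|F| = (#|K| ^ 3)%N.
Proof.
move=> le_n.
have cardS : #|{: K * K + K * K}| = (2 * #|K| ^ 2)%N.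
  by rewrite card_sum !card_prod mul2n addnn.
pose f (z : K * K + K * K) : 'I_n :=
  widen_ord le_n (cast_ord cardS (enum_rank z)).
have f_inj : injective f.
  by move=> x y /(congr1 val)/= /val_inj/enum_rank_inj.
pose inc (p l : K * K) := p.2 == l.1 * p.1 + l.2.
exists (incidence_graph inc f_inj); split.
  apply: incidence_graph_rigid => -[x y] [x' y'] [a b] [a' b'].
  rewrite /inc /= => /eqP-> /eqP-> /eqP E1 /eqP E2.
  have : (a - a') * (x - x') = 0.
    rewrite mulrBl !mulrBr.
    have -> : a * x = a' * x + b' - b by rewrite -E1 addrK.
    have -> : a * x' = a' * x' + b' - b by rewrite -E2 addrK.
    by ring.
  move=> /eqP; rewrite mulf_eq0 !subr_eq0 => /orP[]/eqP E.
    by right; move: E1; rewrite E => /addrI ->.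
  by left; rewrite E.
rewrite card_incidence_graph.
(* An incidence is determined by its line and the abscissa of its point. *)
pose g (z : K * (K * K)) : (K * K) * (K * K) :=
  ((z.1, z.2.1 * z.1 + z.2.2), z.2).
rewrite (_ : #|_| = #|[set g z | z in [set: K * (K * K)]]%SET|).
  rewrite card_imset ?cardsT ?card_prod // => -[x l] [x' l'].
  by rewrite /g => -[-> _ ->]; case: l'.
apply: eq_card => -[[x y] l]; rewrite !inE /inc /=.
apply/eqP/imsetP => [->|[[x' l'] _ [-> -> ->]] //].
by exists (x, l); rewrite ?inE // /g /=.
Qed.

Lemma single_edge_graph n : (2 <= n)%N ->
  exists F : {set edge n}, distance_rigid F /\ #|F| = 1%N.
Proof.
case: n => [|[|n]] // _.
pose f (z : unit + unit) : 'I_n.+2 :=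
  if z is inl _ then ord0 else Ordinal (isT : 1 < n.+2)%N.
have f_inj : injective f by move=> [[]|[]] [[]|[]].
exists (incidence_graph (fun _ _ => true) f_inj); split.
  by apply: incidence_graph_rigid => -[] [] *; left.
rewrite card_incidence_graph (@eq_card _ _ {: unit * unit}) //.
by rewrite card_prod card_unit.
Qed.

(** From [n <= 8 q^2] and [|F| = q^3] follows [n^3 <= 512 |F|^2]. For [n < 8] one edge suffices. *)
Lemma dense_rigid_graph n : (2 <= n)%N ->
  exists F : {set edge n},
    distance_rigid F /\ ((0 < #|F|) && (n ^ 3 <= 512 * #|F| ^ 2))%N.
Proof.
move=> n2; have [n8|n8] := ltnP n 8.
  have [F [rF cF]] := single_edge_graph n2; exists F; split=> //.
  rewrite cF /=.
  by rewrite (@leq_trans (7 ^ 3)%N) // leq_exp2r.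
have [k [k0 lo hi]] : exists k, [/\ (0 < k)%N, (2 * (2 ^ k) ^ 2 <= n)%N &
    (n <= 8 * (2 ^ k) ^ 2)%N].
  (* This choice gives [4^k <= n %/ 2 < 4^(k+1)]; [8 <= n] ensures [0 < k], so that a field with
     [2^k] elements exists. *)
  pose k := trunc_log 4 (n %/ 2).
  have n4 : (4 <= n %/ 2)%N by rewrite leq_divRL.
  have /andP[l1 l2] := @trunc_log_bounds 4 (n %/ 2) isT (ltnW (ltnW (ltnW n4))).
  have E : ((2 ^ k) ^ 2 = 4 ^ k)%N by rewrite -expnM mulnC expnM.
  exists k; rewrite E; split.
  - by rewrite /k trunc_log_gt0.
  - by rewrite -/k in l1; lia.
  - by rewrite -/k expnS in l2; lia.
have [K _ cK] := pPrimePowerField (isT : prime 2) k0.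
have [|F [rF cF]] := @affine_plane_graph K n; first by rewrite cK.
exists F; split=> //; rewrite cF cK !expn_gt0 /=.
apply: leq_trans (_ : (8 * (2 ^ k) ^ 2) ^ 3 <= _)%N; first by rewrite leq_exp2r.
by rewrite expnMn -!(expnM (2 ^ k)%N) leq_mul2r orbC.
Qed.

(** * Lower bounds for spanners *)

(** Lengths are integers: without a path of length at most 3, the infimum is at least 4. *)
Lemma dist_le3_path (R : realType) n (E : {set edge n}) u v :
  (dist R E u v <= 3%:E)%E ->
  exists p : seq 'I_n, [/\ (size p <= 3)%N, path (adj E) u p & last u p = v].
Proof.
move=> d3; apply: contrapT => /forallNP no.
suff : (4%:E <= dist R E u v)%E.
  by move=> /le_trans /(_ d3); rewrite lee_fin; lra.
apply: le_ereal_inf_tmp => _ [p [pp lp] <-]; rewrite lee_fin (ler_nat R 4).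
by rewrite ltnNge; apply/negP => p3; apply: (no p).
Qed.

Lemma dist_adj_le1 (R : realType) n (E : {set edge n}) u v :
  adj E u v -> (dist R E u v <= 1%:E)%E.
Proof. by move=> a; apply: ereal_inf_lbound; exists [:: v] => //=; rewrite a. Qed.

Lemma rigid_spanner (R : realType) n (F G H : {set edge n}) :
  distance_rigid F -> G \subset F ->
  plus2_spanner R G H \/ three_spanner R G H -> H = G.
Proof.
move=> rigid GF sp; have HG : H \subset G by case: sp => -[].
apply: rigid => // u v /(@dist_adj_le1 R) d1; apply: (@dist_le3_path R).
case: sp => -[_ /(_ u v)] /le_trans; apply.
  have -> : (3%:E = 1%:E + 2%:E :> \bar R)%E by congr (_%:E); ring.
  exact: leeD2r.
by rewrite -[leRHS]mule1 lee_pmul2l.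
Qed.

Lemma union_task_complexity (R : realType) (delta : R) :
  0 < delta -> delta < 2^-1 ->
  exists c : R, 0 < c /\
    forall (s : nat) (T : finType) (F : {set T})
      (task : {ffun 'I_s -> {set T}} -> {set T} -> Prop),
    (0 < s)%N -> (0 < #|F|)%N ->
    (forall (x : {ffun 'I_s -> {set T}}) H,
      (forall i, x i \subset F) -> task x H -> H = (\bigcup_i x i)%SET) ->
    ((c * (s%:R + #|F|%:R * ln s%:R))%:E <= comm_complexity delta task)%E.
Proof.
move=> d0 dh.
pose rho := 2^-1 + 2 * delta * (1 - delta).
have rho0 : 0 <= rho by rewrite /rho; nra.
have rho1 : rho < 1.
  rewrite -subr_gt0 (_ : 1 - rho = (1 - 2 * delta) ^+ 2 / 2).
    by rewrite divr_gt0 // exprn_gt0 //; lra.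
  by rewrite /rho; field.
have [t t_large] : exists t, rho ^+ t <= expR (- 8).
  have d1 : 0 < 1 - rho by rewrite subr_gt0.
  (* [rho <= exp (- (1 - rho))], so t above [8 / (1 - rho)] is enough. *)
  exists (Num.bound (8 / (1 - rho))); set t := Num.bound _.
  have t8 : 8 < t%:R * (1 - rho).
    by rewrite -ltr_pdivrMr // archi_boundP // divr_ge0 // ltW.
  apply: (@le_trans _ _ (expR (- (1 - rho)) ^+ t)).
    rewrite lerXn2r ?nnegrE ?expR_ge0 //.
    by apply: le_trans (expR_ge1Dx _); lra.
  by rewrite -expRM_natl ler_expR; lra.
(* The summand 1 keeps the denominator positive for t = 0. For [ln s < 4], [k <= 1/8] suffices since
   [|F| ln s <= 4 |F| <= 8 cost]. *)
pose k : R := expR (- 8) / (16 * (t%:R + 1)).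
have t0 : 0 <= t%:R :> R by [].
have e0 : 0 < expR (- 8) :> R := expR_gt0 _.
have k0 : 0 < k by rewrite divr_gt0 // mulr_gt0 //; lra.
have k8 : k <= 1 / 8.
  have e1 : expR (- 8) <= 1 :> R by rewrite expR_le1; lra.
  by rewrite ler_pdivrMr; nra.
exists ((1 - 2 * delta) * k / 2); split.
  by rewrite divr_gt0 // mulr_gt0 //; lra.
move=> s T F task s0 F0 union.
apply: le_ereal_inf_tmp => _ [P [solP ->]]; rewrite lee_fin.
have sites := cost_ge_sites union solP F0.
have Flns : k * (#|F|%:R * ln s%:R) <= (cost P)%:R.
  have [s_large|s_small] := leP 4 (ln s%:R : R).
    have := cost_ge_information union d0 dh solP t_large s_large.
    set a := #|F|%:R * ln s%:R => h.
    have C0 : 0 <= (cost P)%:R :> R by [].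
    have -> : k * a = expR (- 8) / 16 * a / (t%:R + 1) by rewrite /k; field; lra.
    by rewrite ler_pdivrMr; nra.
  have := card_le_2cost union d0 dh solP (Ordinal s0).
  rewrite -(ler_nat R) natrM => FC.
  have l0 : 0 <= ln s%:R :> R by rewrite ln_ge0 // ler1n.
  have F0' : 0 <= #|F|%:R :> R by [].
  have : #|F|%:R * ln s%:R <= #|F|%:R * 4 :> R by rewrite ler_wpM2l // ltW.
  by nra.
have := sites; set c1 := 1 - 2 * delta; set a := _ * ln _ in Flns * => h.
have c10 : 0 < c1 by rewrite /c1; lra.
have c11 : c1 <= 1 by rewrite /c1; lra.
have C0 : 0 <= (cost P)%:R :> R by [].
have A : k * (c1 * s%:R) <= k * (cost P)%:R by rewrite ler_wpM2l // ltW.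
have B : c1 * (k * a) <= c1 * (cost P)%:R by rewrite ler_wpM2l // ltW.
by nra.
Qed.

Lemma spanner_task_complexity (R : realType) (delta : R) :
  0 < delta -> delta < 2^-1 ->
  exists c : R, 0 < c /\
    forall (n s : nat) (task : {ffun 'I_s -> {set edge n}} -> {set edge n} -> Prop),
    (2 <= n)%N -> (1 <= s)%N ->
    (forall E H, task E H -> plus2_spanner R (union_graph E) H \/
      three_spanner R (union_graph E) H) ->
    ((c * (s%:R + n%:R `^ (3 / 2) * ln s%:R))%:E
       <= comm_complexity delta task)%E.
Proof.
move=> d0 dh; have [c [c0 hc]] := union_task_complexity d0 dh.
(* [512 <= 23^2], so [n^(3/2) <= 23 |F|]. *)
exists (c / 23); split; first by rewrite divr_gt0.
move=> n s task n2 s1 spanner.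
have [F [rigid /andP[F0 nF]]] := dense_rigid_graph n2.
apply: le_trans (hc s (edge n) F task s1 F0 _); last first.
  move=> E H EF /spanner; apply: rigid_spanner rigid _.
  by apply/finset.bigcupsP => i _; exact: EF.
rewrite lee_fin -mulrA ler_pM2l //.
have pF : n%:R `^ (3 / 2) <= 23 * #|F|%:R :> R.
  have p0 : 0 <= n%:R `^ (3 / 2) :> R := powR_ge0 _ _.
  rewrite -(@ler_pXn2r _ 2) ?nnegrE // ?mulr_ge0 //.
  rewrite -powR_mulrn // -powRrM (_ : 3 / 2 * 2 = 3) ?powR_mulrn //; last by field.
  move: nF; rewrite -(ler_nat R) natrM !natrX => nF.
  by apply: le_trans nF _; rewrite exprMn; have := sqr_ge0 (#|F|%:R : R); lra.
have l0 : 0 <= ln s%:R :> R by rewrite ln_ge0 // ler1n.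
have s0 : 0 <= s%:R :> R by [].
have := ler_wpM2r l0 pF; lra.
Qed.

Theorem theorem11 (R : realType) (delta : R)
    (delta_gt0 : 0 < delta) (delta_lt_half : delta < 2^-1) :
  (exists c : R, 0 < c /\
     forall n s : nat, (2 <= n)%N -> (1 <= s)%N ->
       ((c * (s%:R + n%:R `^ (3 / 2) * ln s%:R))%:E
          <= comm_complexity delta (@plus2_spanner_task R n s))%E)
  /\
  (exists c : R, 0 < c /\
     forall n s : nat, (2 <= n)%N -> (1 <= s)%N ->
       ((c * (s%:R + n%:R `^ (3 / 2) * ln s%:R))%:E
          <= comm_complexity delta (@three_spanner_task R n s))%E).
Proof.
have [c [c0 hc]] := spanner_task_complexity delta_gt0 delta_lt_half.
by split; exists c; split=> // n s n2 s1; apply: hc => // E H; [left|right].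
Qed.
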